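(* The space $C_a([0,1])$ is not angelic.
   Context: $C_a([0,1])$ is the set of continuous functions $f:[0,1]\to\mathbb R$ equipped with the topology having as basis the sets $\{g: g(x)<f(x)+\epsilon\ \forall x\in F\}$, for $f\in C([0,1])$, $\epsilon>0$ and finite $F\subseteq[0,1]$. Equivalently, a net $(f_\alpha)$ converges to $f$ iff $\limsup_\alpha f_\alpha(x)\le f(x)$ for all $x\in[0,1]$. Topological spaces are not assumed Hausdorff. A subset $A$ of a topological space $X$ is relatively compact (resp. relatively countably compact) in $X$ if every open cover (resp. every countable open cover) of $X$ has a finite subfamily covering $A$. A topological space $X$ is angelic if for every relatively countably compact subset $A\subseteq X$: (i) $A$ is relatively compact, and (ii) for each $a\in\mathrm{cl}\,A$ there is a sequence in $A$ converging to $a$. *)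

(* Defs.v *)
From HB Require Import structures.
From mathcomp Require Import all_boot all_order all_algebra.
From mathcomp Require Import all_classical all_reals all_analysis.

Set Implicit Arguments.
Unset Strict Implicit.
Unset Printing Implicit Defensive.

Import Order.TTheory GRing.Theory Num.Theory.
Import numFieldNormedType.Exports.

Local Open Scope classical_set_scope.
Local Open Scope ring_scope.

(* The cover ranges over the whole space X, only the finite subcover is asked
   to cover A; no separation axiom is assumed, so this is weaker in general
   than compactness of the closure of A. *)
Definition relatively_compact (X : topologicalType) (A : set X) : Prop :=
  forall C : set (set X), C `<=` open -> cover C id = setT ->
    finite_subset_cover C id A.

Definition relatively_countably_compact (X : topologicalType) (A : set X)
    : Prop :=
  forall C : set (set X), countable C -> C `<=` open -> cover C id = setT ->
    finite_subset_cover C id A.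

Definition angelic (X : topologicalType) : Prop :=
  forall A : set X, relatively_countably_compact A ->
    relatively_compact A /\
    (forall a, closure A a ->
      exists u : nat -> X, (forall n, A (u n)) /\ u @ \oo --> a).

Definition I01 (R : realType) : Type := set_type (`[0, 1]%classic : set R).

HB.instance Definition _ (R : realType) :=
  Topological.copy (I01 R) (set_type (`[0, 1]%classic : set R)).

(* A copy of the type of continuous functions [0,1] -> R, where [0,1] carries
   the subspace topology. The alias keeps the topology declared below apart from
   the compact-open topology that the library puts on [continuousType]. *)
Definition Ca (R : realType) : Type := continuousType (I01 R) R.

HB.instance Definition _ (R : realType) := gen_eqMixin (Ca R).
HB.instance Definition _ (R : realType) := gen_choiceMixin (Ca R).

Definition Ca_nbhd (R : realType) (f : Ca R) (e : R)
    (F : set (I01 R)) : set (Ca R) :=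
  [set g : Ca R | forall x, F x -> g x < f x + e].

Definition Ca_basis (R : realType) : set (set (Ca R)) :=
  [set U | exists (f : Ca R) (e : R) (F : set (I01 R)),
     [/\ 0 < e, finite_set F & U = Ca_nbhd f e F]].

Section Ca_topology.
Variable R : realType.

Let Ca_basis_cover : \bigcup_(U in @Ca_basis R) id U = setT.
Proof.
apply/seteqP; split => // f _; exists (Ca_nbhd f 1 set0) => //.
by exists f, 1, set0.
Qed.

Let Ca_basis_join (U V : set (Ca R)) (h : Ca R) :
  Ca_basis U -> Ca_basis V -> U h -> V h ->
  exists W, [/\ Ca_basis W, W h & W `<=` U `&` V].
Proof.
have gap (f : Ca R) (e : R) (F : set (I01 R)) :
    finite_set F -> Ca_nbhd f e F h ->
    exists2 d, 0 < d & forall x, F x -> h x + d <= f x + e.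
  move=> /finite_setP[n]; elim: n F => [F|n IHn F].
    by rewrite II0 card_eq0 => /eqP -> _; exists 1.
  move=> /eq_cardSP[x Fx /IHn FDx] hF.
  have [y [Fy _]|d d0 hd] := FDx; first exact: hF.
  exists (Num.min d (f x + e - h x)).
    by rewrite lt_min d0 subr_gt0 hF.
  move=> y Fy; have [->|yx] := EM (y = x).
    by rewrite addrC -lerBrDr ge_min lexx orbT.
  apply: le_trans (hd y (conj Fy yx)).
  by rewrite lerD2l ge_min lexx.
move=> [f1 [e1 [F1 [_ fF1 ->]]]] [f2 [e2 [F2 [_ fF2 ->]]]].
move=> /(gap _ _ _ fF1)[d1 d10 h1] /(gap _ _ _ fF2)[d2 d20 h2].
exists (Ca_nbhd h (Num.min d1 d2) (F1 `|` F2)); split.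
- exists h, (Num.min d1 d2), (F1 `|` F2).
  by rewrite lt_min d10 d20 finite_setU; split.
- by move=> x _; rewrite ltrDl lt_min d10 d20.
- move=> g hg; split=> x Fx.
  + apply: lt_le_trans (h1 x Fx); apply: lt_le_trans (hg x (or_introl Fx)) _.
    by rewrite lerD2l ge_min lexx.
  + apply: lt_le_trans (h2 x Fx); apply: lt_le_trans (hg x (or_intror Fx)) _.
    by rewrite lerD2l ge_min lexx orbT.
Qed.

HB.instance Definition _ :=
  isBaseTopological.Build (Ca R) Ca_basis_cover Ca_basis_join.

End Ca_topology.

(* Main.v *)
Require Import Defs.
From mathcomp Require Import all_boot all_order all_algebra.
From mathcomp Require Import finmap measurable_realfun.
From mathcomp Require Import all_classical all_reals all_analysis.

(** The topology of [Ca R] only sees upper bounds, so an open set is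
    stable under passing to a pointwise smaller function. A set [A] with a
    continuous upper bound [h] is therefore contained in every open set that
    contains [h], and one member of any open cover already covers [A]. Such
    an [A] is thus relatively compact for free, and angelicity would make every
    point of its closure the limit of a sequence in [A].

    Take for [A] the continuous functions with values in [[0, 1]] and integral
    at least [1/2]. The zero function is in its closure: a basic neighbourhood
    of [0] constrains only finitely many points, and a function can vanish
    there and still be close to [1] almost everywhere
    ([vanishing_half_mass]). But no sequence of [A] tends to [0]: the members
    of [A] are nonnegative, so it would tend to [0] pointwise, and by dominated
    convergence the integrals would tend to [0] too. Both halves rest on
    [cvg_integral01], dominated convergence on the unit interval. *)

Set Implicit Arguments.
Unset Strict Implicit.
Unset Printing Implicit Defensive.

Import Order.TTheory GRing.Theory Num.Theory.
Import numFieldNormedType.Exports.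

Local Open Scope classical_set_scope.
Local Open Scope ring_scope.

Section upper_topology.
Variable R : realType.
Implicit Types (f g : Ca R) (U : set (Ca R)).

Lemma open_Ca_sub_basis U f : open U -> U f ->
  exists V, [/\ Ca_basis V, V f & V `<=` U].
Proof.
move=> [D sD <-] [V DV Vf]; exists V; split=> //; first exact: sD.
by move=> g Vg; exists V.
Qed.

Lemma open_Ca_le U f g : open U -> U f -> (forall x, g x <= f x) -> U g.
Proof.
move=> oU Uf gf; have [V [[h [e [F [_ _ ->]]]] hf]] := open_Ca_sub_basis oU Uf.
by apply=> x Fx; apply: le_lt_trans (gf x) (hf x Fx).
Qed.

Lemma nbhs_Ca_nbhd f (e : R) (F : set (I01 R)) :
  0 < e -> finite_set F -> nbhs f (Ca_nbhd f e F).
Proof.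
move=> e0 finF; apply: open_nbhs_nbhs; split; last by move=> x _; rewrite ltrDl.
exists [set Ca_nbhd f e F]; last by rewrite bigcup_set1.
by move=> _ ->; exists f, e, F.
Qed.

(** The member of the cover that contains the upper bound contains [A]. *)
Lemma Ca_bounded_relatively_compact (A : set (Ca R)) f :
  (forall g, A g -> forall x, g x <= f x) -> relatively_countably_compact A.
Proof.
move=> Af C _ oC covC.
have [U CU Uf] : cover C id f by rewrite covC.
exists [fset U]%fset; first by move=> V; rewrite inE => /eqP ->; exact/mem_set.
move=> g Ag; exists U; first exact/fset1P.
exact: open_Ca_le (oC _ CU) Uf (Af g Ag).
Qed.

End upper_topology.

Section unit_interval.
Variable R : realType.
Local Notation mu := (@lebesgue_measure R).
Local Notation D := (`[0, 1]%classic : set R).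

Lemma cvg_integral01 (h : nat -> R -> R) (Z : set R) (c : R) :
  (forall n, continuous (h n)) -> (forall n x, 0 <= h n x <= 1) ->
  countable Z -> (forall x, D x -> ~ Z x -> h n x @[n --> \oo] --> c) ->
  (\int[mu]_(x in D) (h n x)%:E)%E @[n --> \oo] --> c%:E.
Proof.
move=> hc h01 cZ hcvg.
have mD : measurable D by exact: measurable_itv.
have -> : c%:E = (\int[mu]_(x in D) cst c%:E x)%E.
  rewrite integral_cst//= lebesgue_measure_itv/= lte_fin ltr01.
  by rewrite oppr0 adde0 mule1.
have [] // := @dominated_convergence _ _ R mu D mD
  (fun n x => (h n x)%:E) (cst c%:E) (cst 1%E).
- move=> n; apply/measurable_EFinP.
  by apply: measurable_funTS; exact: continuous_measurable_fun.
- exists Z; split.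
  + exact: countable_measurable.
  + exact: countable_lebesgue_measure0.
  + move=> x /= /not_implyP[Dx nc]; apply: contrapT => nZ; apply: nc.
    by apply/cvg_EFin; [exact: nearW|exact: hcvg].
- apply: (@continuous_compact_integrable R (cst 1)).
    exact: segment_compact.
  by move=> x; exact: cvg_cst.
- apply: aeW => x n _ /=.
  by rewrite lee_fin ger0_norm; case/andP: (h01 n x).
Qed.

(** With [P] the polynomial with roots [s], the functions
    [1 - (1 + P ^ 2) ^- n] vanish on [s] and increase to [1] elsewhere,
    so that their integrals tend to [1]. *)
Lemma vanishing_half_mass (s : seq R) : exists h : R -> R,
  [/\ continuous h, forall x, 0 <= h x <= 1, forall x, x \in s -> h x = 0 &
      (2^-1%:E <= \int[mu]_(x in D) (h x)%:E)%E].
Proof.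
pose P := \prod_(a <- s) ('X - a%:P); pose q x := (1 + P.[x] ^+ 2)^-1.
have P0 x : 0 < 1 + P.[x] ^+ 2 by rewrite ltr_pwDl// sqr_ge0.
have q01 x : 0 <= q x <= 1.
  by rewrite invr_ge0 ltW//= invf_le1// lerDl sqr_ge0.
pose h n x := 1 - q x ^+ n.
have hc n : continuous (h n).
  move=> x; apply: cvgB; first exact: cvg_cst.
  apply: (@continuous_comp _ _ _ q (fun y => y ^+ n)); last exact: exprn_continuous.
  apply: cvgV; first by rewrite gt_eqF.
  apply: cvgD; first exact: cvg_cst.
  apply: (@continuous_comp _ _ _ (horner P) (fun y => y ^+ 2)).
    exact: continuous_horner.
  exact: exprn_continuous.
have h01 n x : 0 <= h n x <= 1.
  case/andP: (q01 x) => q0 q1.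
  by rewrite subr_ge0 exprn_ile1//= gerBl exprn_ge0.
have hcvg x : D x -> ~ [set` s] x -> h n x @[n --> \oo] --> (1 : R).
  move=> _ /negP xs; rewrite -[X in _ --> X]subr0.
  apply: cvgB; first exact: cvg_cst.
  apply: cvg_expr; case/andP: (q01 x) => q0 q1; rewrite ger0_norm// invf_lt1//.
  rewrite ltrDl exprn_even_gt0//=.
  by rewrite -[_ == _]/(root P x) root_prod_XsubC.
have cs : countable [set` s] by apply: finite_set_countable; exact: finite_seq.
have half1 : ((2^-1 : R)%:E < 1)%E by rewrite lte_fin invf_lt1// ltr1n.
have [n intn] : exists n, (2^-1%:E <= \int[mu]_(x in D) (h n x)%:E)%E.
  apply: contrapT => /forallNP small; move: half1; rewrite ltNge => /negP; apply.
  apply: cvge_to_le (cvg_integral01 hc h01 cs hcvg) _.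
  by apply: nearW => n; rewrite leNgt; apply/negP => /ltW; exact: small.
exists (h n); split=> // x; rewrite -root_prod_XsubC => /eqP Px.
by rewrite /h /q Px expr0n/= addr0 invr1 expr1n subrr.
Qed.

End unit_interval.

Section half_mass.
Variable R : realType.
Local Notation mu := (@lebesgue_measure R).
Local Notation D := (`[0, 1]%classic : set R).

Definition restr01 (h : R -> R) (hc : continuous h) : Ca R :=
  mkcts (fun x : I01 R =>
    continuous_comp (@initial_continuous _ R set_val x) (hc (set_val x))).

(** Each function is given by an extension to the line, where the Lebesgue
    integral lives; the integral only depends on the function on [[0, 1]]. *)
Definition half_mass : set (Ca R) :=
  [set g | exists h : R -> R, [/\ continuous h, forall x, 0 <= h x <= 1,
     forall x : I01 R, g x = h (set_val x) &
     (2^-1%:E <= \int[mu]_(x in D) (h x)%:E)%E]].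

Definition zero_Ca : Ca R := cst 0.
Definition one_Ca : Ca R := cst 1.

Lemma half_mass_relatively_countably_compact :
  relatively_countably_compact half_mass.
Proof.
apply: (@Ca_bounded_relatively_compact _ _ one_Ca) => g [h [_ h01 gh _]] x.
by rewrite gh; case/andP: (h01 (set_val x)).
Qed.

(** The basic set [Ca_nbhd f e F] around [0] need not be centred at [0], but it
    contains every function that agrees with [0] on [F]. *)
Lemma closure_half_mass_zero : closure half_mass zero_Ca.
Proof.
move=> U; rewrite nbhsE => -[V [oV V0] VU].
have [W [[f [e [F [_ finF ->]]]] W0 WV]] := open_Ca_sub_basis oV V0.
have /finite_seqP[s Fs] := finF.
have [h [hc h01 hs inth]] := vanishing_half_mass (map set_val s).
exists (restr01 hc); split; first by exists h; split.
apply/VU/WV => x Fx; have -> : restr01 hc x = 0; last exact: W0.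
by apply: hs; apply/map_f; move: Fx; rewrite Fs.
Qed.

(** Convergence to [0] bounds the limsup at each point by [0]; nonnegativity
    turns this into pointwise convergence. *)
Lemma half_mass_no_sequence_to_zero (u : nat -> Ca R) :
  (forall n, half_mass (u n)) -> ~ (u @ \oo --> zero_Ca).
Proof.
move=> /choice[h hP] u0.
have h01 n x : 0 <= h n x <= 1 by have [_ + _ _] := hP n; exact.
have hcvg x : D x -> ~ set0 x -> h n x @[n --> \oo] --> (0 : R).
  move=> Dx _; apply/cvgr0Pnorm_lt => e e0.
  pose y : I01 R := exist _ x (mem_set Dx).
  have un : \forall n \near \oo, Ca_nbhd zero_Ca e [set y] (u n).
    exact: u0 _ (nbhs_Ca_nbhd zero_Ca e0 (finite_set1 y)).
  apply: filterS un => n /(_ y erefl).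
  have [_ _ -> _] := hP n; rewrite add0r ger0_norm//.
  by case/andP: (h01 n x).
have hc n : continuous (h n) by have [] := hP n.
have int0 := cvg_integral01 hc h01 (countable0 _) hcvg.
have : (2^-1%:E <= (0 : R)%:E)%E.
  by apply: cvge_to_ge int0 _; apply: nearW => n; have [] := hP n.
by rewrite lee_fin invr_le0 lern0.
Qed.

End half_mass.

Theorem theorem5p9 (R : realType) : ~ angelic (Ca R).
Proof.
move=> /(_ _ (@half_mass_relatively_countably_compact R))[_].
move=> /(_ _ (@closure_half_mass_zero R))[u [uA]].
exact: half_mass_no_sequence_to_zero.
Qed.
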